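(* Let $\sigma, \tau$ be polygonal curves in $\mathbb{R}^d$ with vertices $v^\sigma_1, \dots, v^\sigma_{\lvert \sigma \rvert}$, respectively $v^\tau_1, \dots, v^\tau_{\lvert \tau \rvert}$. There is a set $P'\subset\mathbb{R}^d$ of points determined by $\sigma$ and $\tau$ (i.e. depending only on $\sigma$ and $\tau$) with $\lvert P' \rvert \in O(\lvert \sigma \rvert \cdot \lvert \tau \rvert)$ (with an absolute hidden constant) such that the following holds. Let $\epsilon>0$ with $\epsilon/48\in(0,1)$, let $f\colon\mathbb{R}^d\to\mathbb{R}^{d'}$ be a linear $(1 \pm \epsilon/48)$-embedding for $P = \{v^\sigma_1, \dots, v^\sigma_{\lvert \sigma \rvert}, v^\tau_1, \dots, v^\tau_{\lvert \tau \rvert} \} \cup P'$, and let $\sigma'$ and $\tau'$ be the polygonal curves with vertices $f(v^\sigma_1), \dots, f(v^\sigma_{\lvert \sigma \rvert})$, respectively $f(v^\tau_1), \dots, f(v^\tau_{\lvert \tau \rvert})$. Then $d_{wF}(\sigma', \tau') \geq (1-\epsilon)\, d_{wF}(\sigma, \tau)$ and $d_F(\sigma', \tau') \geq (1-\epsilon)\, d_F(\sigma, \tau)$.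
   Context: For $\delta\in(0,1)$, a function $f\colon\mathbb{R}^d\to\mathbb{R}^{d'}$ is a $(1\pm\delta)$-embedding for $P\subset\mathbb{R}^d$ if $(1-\delta)\|p-q\|\le\|f(p)-f(q)\|\le(1+\delta)\|p-q\|$ for all $p,q\in P$ (Euclidean norms). A curve is a continuous map $\tau\colon[0,1]\to\mathbb{R}^d$; it is polygonal if there are vertices $v_1,\dots,v_m$, no three consecutive on a line, and instants $0=t_1<\dots<t_m=1$ with $\tau(t_i)=v_i$ such that $\tau$ is linear between consecutive instants; $m=|\tau|$ is its complexity. The image curves $\sigma',\tau'$ are piecewise linear through the listed vertices (non-collinearity not required of them). The weak Fréchet distance is $d_{wF}(\sigma,\tau)=\inf_{a,b}\max_{t\in[0,1]}\|\sigma(a(t))-\tau(b(t))\|$ over continuous $a,b\colon[0,1]\to[0,1]$ with $a(0)=b(0)=0$, $a(1)=b(1)=1$; the Fréchet distance $d_F(\sigma,\tau)$ is the same infimum over continuous bijections $a,b$ with $a(0)=b(0)=0$, $a(1)=b(1)=1$. *)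

(* Defs.v *)
From HB Require Import structures.
From mathcomp Require Import all_boot all_order all_algebra finmap.
From mathcomp Require Import all_classical all_reals all_analysis.

Set Implicit Arguments.
Unset Strict Implicit.
Unset Printing Implicit Defensive.

Import Order.TTheory GRing.Theory Num.Theory.
Import numFieldNormedType.Exports.

Local Open Scope classical_set_scope.
Local Open Scope ring_scope.

(* Euclidean norm; the library's `|x| on row vectors is the sup norm (which
   induces the same topology, so continuity of curves is unaffected). *)
Definition enorm (R : realType) (d : nat) (x : 'rV[R]_d) : R :=
  Num.sqrt (\sum_(i < d) x ord0 i ^+ 2).

Definition embedding (R : realType) (d d' : nat) (delta : R)
    (f : 'rV[R]_d -> 'rV[R]_d') (P : set 'rV[R]_d) : Prop :=
  forall p q, P p -> P q ->
    (1 - delta) * enorm (p - q) <= enorm (f p - f q) <=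
    (1 + delta) * enorm (p - q).

(* Curves are represented by functions on all of R, of which only the
   restriction to [0, 1] is ever used. *)
Definition curve (R : realType) (d : nat) (c : R -> 'rV[R]_d) : Prop :=
  {within `[0, 1], continuous c}.

Definition on_a_line (R : realType) (d : nat) (p q r : 'rV[R]_d) : Prop :=
  exists x u : 'rV[R]_d, u != 0 /\
    [set p; q; r] `<=` [set x + a *: u | a in [set: R]].

(* The conditions on t force size v >= 2; c takes the value v`_i at t`_i
   (the cases s = 0 and s = 1). *)
Definition piecewise_linear (R : realType) (d : nat) (v : seq 'rV[R]_d)
    (c : R -> 'rV[R]_d) : Prop :=
  curve c /\
  exists t : seq R,
    [/\ size t = size v, t`_0 = 0, last 0 t = 1, sorted <%R t &
      forall i : nat, (i.+1 < size v)%N -> forall s : R, s \in `[0, 1] ->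
        c ((1 - s) * t`_i + s * t`_i.+1) = (1 - s) *: v`_i + s *: v`_i.+1].

(* c is a polygonal curve with vertices v; its complexity is size v. *)
Definition polygonal (R : realType) (d : nat) (v : seq 'rV[R]_d)
    (c : R -> 'rV[R]_d) : Prop :=
  piecewise_linear v c /\
  forall i : nat, (i.+2 < size v)%N -> ~ on_a_line v`_i v`_i.+1 v`_i.+2.

Definition weak_reparam (R : realType) : set (R -> R) :=
  [set a : R -> R | [/\ {within `[0, 1], continuous a},
               set_fun `[0, 1] `[0, 1] a, a 0 = 0 & a 1 = 1]].

Definition reparam (R : realType) : set (R -> R) :=
  [set a : R -> R | [/\ {within `[0, 1], continuous a},
               set_bij `[0, 1] `[0, 1] a, a 0 = 0 & a 1 = 1]].

(* A maximum: the function of t is continuous on the compact [0, 1]. *)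
Definition width (R : realType) (d : nat) (sigma tau : R -> 'rV[R]_d)
    (a b : R -> R) : R :=
  sup [set enorm (sigma (a t) - tau (b t)) | t in `[0, 1]].

Definition weak_frechet (R : realType) (d : nat)
    (sigma tau : R -> 'rV[R]_d) : R :=
  inf [set width sigma tau a b |
        a in @weak_reparam R & b in @weak_reparam R].

Definition frechet (R : realType) (d : nat) (sigma tau : R -> 'rV[R]_d) : R :=
  inf [set width sigma tau a b | a in @reparam R & b in @reparam R].

(* Main.v *)
Require Import Defs.
From HB Require Import structures.
From mathcomp Require Import all_boot all_order all_algebra finmap.
From mathcomp Require Import all_classical all_reals all_analysis.
From mathcomp Require Import ring lra zify.

Set Implicit Arguments.
Unset Strict Implicit.
Unset Printing Implicit Defensive.

Import Order.TTheory GRing.Theory Num.Theory.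
Import numFieldNormedType.Exports.

Local Open Scope classical_set_scope.
Local Open Scope ring_scope.

(* For an edge [v, v'] of sigma and an edge [w, w'] of tau, every difference
   sigma(x) - tau(y) lies in the span of v - w, v' - v and w' - w.  P' consists
   of the origin and of an orthonormal basis of each of these spans: a linear
   (1 +- delta)-embedding of P' has a nearly orthonormal Gram matrix on each
   basis, so it shrinks every vector of the span by at most a factor
   sqrt (1 - 15 delta), and this exceeds 1 - eps for delta = eps/48.  Thus all
   widths are nearly preserved pointwise, up to the piecewise-linear
   reparametrization matching the instants of f o sigma with those of sigma'. *)

(** * Inner product and Euclidean norm *)

Definition dot (R : realType) (d : nat) (x y : 'rV[R]_d) : R :=
  \sum_(i < d) x ord0 i * y ord0 i.

Lemma dotC (R : realType) d (x y : 'rV[R]_d) : dot x y = dot y x.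
Proof. by apply: eq_bigr => i _; rewrite mulrC. Qed.

Lemma dotDl (R : realType) d (x y z : 'rV[R]_d) :
  dot (x + y) z = dot x z + dot y z.
Proof. by rewrite -big_split; apply: eq_bigr => i _; rewrite mxE mulrDl. Qed.

Lemma dotZl (R : realType) d a (x y : 'rV[R]_d) : dot (a *: x) y = a * dot x y.
Proof. by rewrite mulr_sumr; apply: eq_bigr => i _; rewrite mxE mulrA. Qed.

Lemma dotDr (R : realType) d (x y z : 'rV[R]_d) :
  dot z (x + y) = dot z x + dot z y.
Proof. by rewrite dotC dotDl !(dotC z). Qed.

Lemma dotZr (R : realType) d a (x y : 'rV[R]_d) : dot y (a *: x) = a * dot y x.
Proof. by rewrite dotC dotZl dotC. Qed.

Lemma dotNl (R : realType) d (x y : 'rV[R]_d) : dot (- x) y = - dot x y.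
Proof. by rewrite -scaleN1r dotZl mulN1r. Qed.

Lemma dotNr (R : realType) d (x y : 'rV[R]_d) : dot y (- x) = - dot y x.
Proof. by rewrite dotC dotNl dotC. Qed.

Lemma dot0l (R : realType) d (x : 'rV[R]_d) : dot 0 x = 0.
Proof. by rewrite -(scale0r 0) dotZl mul0r. Qed.

Definition dotE := (dotDl, dotDr, dotNl, dotNr, dotZl, dotZr).

Lemma dot_ge0 (R : realType) d (x : 'rV[R]_d) : 0 <= dot x x.
Proof. by apply: sumr_ge0 => i _; rewrite -expr2 sqr_ge0. Qed.

Lemma dot_eq0 (R : realType) d (x : 'rV[R]_d) : dot x x = 0 -> x = 0.
Proof.
move/eqP; rewrite psumr_eq0; last by move=> i _; rewrite -expr2 sqr_ge0.
move=> /allP x0; apply/rowP => i; rewrite mxE.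
by have := x0 i (mem_index_enum i); rewrite /= mulf_eq0 orbb => /eqP.
Qed.

Lemma enorm_ge0 (R : realType) d (x : 'rV[R]_d) : 0 <= enorm x.
Proof. exact: sqrtr_ge0. Qed.

Lemma enorm_sqr (R : realType) d (x : 'rV[R]_d) : enorm x ^+ 2 = dot x x.
Proof.
rewrite sqr_sqrtr; last by apply: sumr_ge0 => i _; exact: sqr_ge0.
by apply: eq_bigr => i _; rewrite expr2.
Qed.

(** * Orthonormal frames and their distortion by linear embeddings *)

Lemma normalize (R : realType) d (x : 'rV[R]_d) :
  exists k c, (dot (k *: x) (k *: x) = 0 \/ dot (k *: x) (k *: x) = 1) /\
    x = c *: (k *: x).
Proof.
have [->|x0] := eqVneq x 0.
  by exists 0, 0; rewrite !scaler0 dot0l; split; [left|].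
have nx0 : enorm x != 0.
  apply: contra_neq x0 => nx; apply: dot_eq0.
  by rewrite -enorm_sqr nx expr0n.
exists (enorm x)^-1, (enorm x); split.
  by right; rewrite !dotE -enorm_sqr; field.
by rewrite scalerA divff // scale1r.
Qed.

(* Gram-Schmidt; a vector depending on the previous ones contributes e = 0. *)
Lemma gram_schmidt3 (R : realType) d (x y z : 'rV[R]_d) :
  exists e1 e2 e3 : 'rV[R]_d,
  [/\ [/\ dot e1 e1 = 0 \/ dot e1 e1 = 1, dot e2 e2 = 0 \/ dot e2 e2 = 1 &
          dot e3 e3 = 0 \/ dot e3 e3 = 1],
      [/\ dot e1 e2 = 0, dot e1 e3 = 0 & dot e2 e3 = 0] &
      forall a b c, exists a' b' c',
        a *: x + b *: y + c *: z = a' *: e1 + b' *: e2 + c' *: e3].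
Proof.
have ortho_proj (e u : 'rV[R]_d) : dot e e = 0 \/ dot e e = 1 ->
    dot e (u - dot e u *: e) = 0.
  by rewrite !dotE => -[/[dup] /dot_eq0 ->|] ->; rewrite ?dot0l; ring.
have [k1 [c1 [n1 xE]]] := normalize x.
set e1 := k1 *: x in n1 xE.
have [k2 [c2 [n2 yE]]] := normalize (y - dot e1 y *: e1).
set e2 := k2 *: _ in n2 yE.
have e12 : dot e1 e2 = 0 by rewrite dotZr ortho_proj // mulr0.
set w := z - dot e1 z *: e1.
have [k3 [c3 [n3 zE]]] := normalize (w - dot e2 w *: e2).
set e3 := k3 *: _ in n3 zE.
have e23 : dot e2 e3 = 0 by rewrite dotZr ortho_proj // mulr0.
have e13 : dot e1 e3 = 0.
  have w1 : dot e1 w = 0 by exact: ortho_proj.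
  by rewrite /e3 dotZr dotDr dotNr (dotZr (dot e2 w)) w1 e12; ring.
exists e1, e2, e3; split=> // a b c.
(* Coefficients obtained by substituting [x = c1 *: e1], [y = c2 *: e2 + dot e1 y *: e1] and [z = c3
   *: e3 + dot e2 w *: e2 + dot e1 z *: e1]. *)
exists (a * c1 + b * dot e1 y + c * dot e1 z), (b * c2 + c * dot e2 w), (c * c3).
rewrite {1}xE -{1}(subrK (dot e1 y *: e1) y) yE.
rewrite -{1}(subrK (dot e1 z *: e1) z) -/w -{1}(subrK (dot e2 w *: e2) w) zE.
by apply/rowP => i; rewrite !mxE; ring.
Qed.

(* m, n are the squared norms of two orthogonal vectors, each 0 or 1, and
   p, g, q the entries of the Gram matrix of their images. *)
Lemma gram_cross (R : realType) (delta m n p q g a b : R) :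
  0 < delta < 1 -> m = 0 \/ m = 1 -> n = 0 \/ n = 1 ->
  0 <= p <= (1 + delta) ^+ 2 * m -> 0 <= q <= (1 + delta) ^+ 2 * n ->
  (m = 0 -> g = 0) -> (n = 0 -> g = 0) ->
  p + q - 2 * g <= (1 + delta) ^+ 2 * (m + n) ->
  (1 - delta) ^+ 2 * (m + n) <= p + q - 2 * g ->
  (1 - delta) ^+ 2 * m <= p -> (1 - delta) ^+ 2 * n <= q ->
  - (6 * delta * (a ^+ 2 * m + b ^+ 2 * n)) <= 2 * (a * b) * g.
Proof.
move=> d01 [->|->].
  by move=> [->|->] _ _ g0 ?; [rewrite g0 //; nra|rewrite g0 //; nra].
move=> [->|->]; first by move=> _ _ _ g0; rewrite g0 //; nra.
rewrite !mulr1 => p01 q01 _ _ u l pl ql.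
(* Polarization: comparing [p + q - 2 * g] with [p] and [q] already gives [4 * delta] as a bound for
   the absolute value of [g]; 6 leaves slack. *)
have g1 : - (6 * delta) <= g by nra.
have g2 : g <= 6 * delta by nra.
(* The sign of [a * b] decides which bound on [g] applies; twice the absolute value of [a * b] is
   then at most [a ^+ 2 + b ^+ 2]. *)
have [ab|ab] := leP 0 (a * b).
  have : 0 <= (a * b) * (g + 6 * delta) by apply: mulr_ge0; lra.
  have : 0 <= delta * (a - b) ^+ 2 by apply: mulr_ge0; [lra|exact: sqr_ge0].
  nra.
have : 0 <= (- (a * b)) * (6 * delta - g) by apply: mulr_ge0; lra.
have : 0 <= delta * (a + b) ^+ 2 by apply: mulr_ge0; [lra|exact: sqr_ge0].
nra.
Qed.

(* The Gram matrix of the f e_k differs from that of the e_k by at most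
   3 delta on the diagonal and 6 delta off it, whence 3 + 2 * 6 = 15. *)
Lemma embedding_frame (R : realType) d d' (delta : R)
    (f : {linear 'rV[R]_d -> 'rV[R]_d'}) (P : set 'rV[R]_d)
    (e1 e2 e3 : 'rV[R]_d) :
  0 < delta < 1 -> embedding delta f P -> P 0 -> P e1 -> P e2 -> P e3 ->
  dot e1 e1 = 0 \/ dot e1 e1 = 1 -> dot e2 e2 = 0 \/ dot e2 e2 = 1 ->
  dot e3 e3 = 0 \/ dot e3 e3 = 1 ->
  dot e1 e2 = 0 -> dot e1 e3 = 0 -> dot e2 e3 = 0 ->
  forall a b c (x : 'rV[R]_d), x = a *: e1 + b *: e2 + c *: e3 ->
    (1 - 15 * delta) * dot x x <= dot (f x) (f x).
Proof.
move=> d01 emb P0 P1 P2 P3 n1 n2 n3 o12 o13 o23 a b c x xE.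
have sq p q : P p -> P q ->
    (1 - delta) ^+ 2 * dot (p - q) (p - q) <= dot (f (p - q)) (f (p - q))
      <= (1 + delta) ^+ 2 * dot (p - q) (p - q).
  move=> Pp Pq; have := emb _ _ Pp Pq; rewrite -raddfB => /andP[l u].
  rewrite -!enorm_sqr -!exprMn; apply/andP; split; rewrite ler_sqr //;
    rewrite nnegrE ?enorm_ge0 // mulr_ge0 ?enorm_ge0 //; lra.
have diag p : P p ->
    (1 - delta) ^+ 2 * dot p p <= dot (f p) (f p) <= (1 + delta) ^+ 2 * dot p p.
  by move=> Pp; have := sq _ _ Pp P0; rewrite subr0.
have null p q : dot p p = 0 -> dot (f p) (f q) = 0.
  by move=> /dot_eq0 ->; rewrite raddf0 dot0l.
have cross p q s t : P p -> P q -> dot p p = 0 \/ dot p p = 1 ->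
    dot q q = 0 \/ dot q q = 1 -> dot p q = 0 ->
    - (6 * delta * (s ^+ 2 * dot p p + t ^+ 2 * dot q q))
      <= 2 * (s * t) * dot (f p) (f q).
  move=> Pp Pq np nq pq.
  have /andP[lp up] := diag _ Pp; have /andP[lq uq] := diag _ Pq.
  have := sq _ _ Pp Pq.
  rewrite raddfB /= !dotE (dotC q p) pq (dotC (f q) (f p)) => /andP[l u].
  apply: (@gram_cross _ delta _ _ (dot (f p) (f p)) (dot (f q) (f q))) => //.
  - by rewrite dot_ge0.
  - by rewrite dot_ge0.
  - exact: null.
  - by move=> /null; rewrite dotC.
  - by apply: le_trans (le_trans u _); lra.
  - by apply: le_trans (le_trans _ l) _; lra.
have low p s : P p -> (1 - 3 * delta) * (s ^+ 2 * dot p p)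
    <= s ^+ 2 * dot (f p) (f p).
  move=> Pp; have /andP[l _] := diag _ Pp; rewrite mulrCA.
  apply: (ler_wpM2l (sqr_ge0 _)); apply: le_trans l.
  by apply: (ler_wpM2r (dot_ge0 _)); nra.
have fxE : f x = a *: f e1 + b *: f e2 + c *: f e3 by rewrite xE !linearD !linearZ.
rewrite fxE xE !dotE.
rewrite (dotC e2 e1) (dotC e3 e1) (dotC e3 e2) o12 o13 o23.
rewrite (dotC (f e2) (f e1)) (dotC (f e3) (f e1)) (dotC (f e3) (f e2)).
have := cross _ _ a b P1 P2 n1 n2 o12.
have := cross _ _ a c P1 P3 n1 n3 o13.
have := cross _ _ b c P2 P3 n2 n3 o23.
have := low _ a P1; have := low _ b P2; have := low _ c P3.
move: (dot e1 e1) (dot e2 e2) (dot e3 e3) (dot (f e1) (f e1)) (dot (f e2) (f e2)).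
move: (dot (f e3) (f e3)) (dot (f e1) (f e2)) (dot (f e1) (f e3)) (dot (f e2) (f e3)).
move=> *.
lra.
Qed.

(** The frame is chosen before [d'], [eps] and [f], which is what makes P' depend on the curves
    alone. *)
Lemma embedding_span3 (R : realType) d (x y z : 'rV[R]_d) :
  exists es : 3.-tuple 'rV[R]_d,
  forall d' (eps : R) (f : {linear 'rV[R]_d -> 'rV[R]_d'}) (P : set 'rV[R]_d),
    0 < eps -> 0 < eps / 48 < 1 -> embedding (eps / 48) f P ->
    P 0 -> [set` es] `<=` P ->
  forall a b c (u : 'rV[R]_d), u = a *: x + b *: y + c *: z ->
    (1 - eps) * enorm u <= enorm (f u).
Proof.
have [e1 [e2 [e3 [[n1 n2 n3] [p12 p13 p23] spanE]]]] := gram_schmidt3 x y z.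
exists [tuple e1; e2; e3] => d' eps f P eps0 eps48 emb P0 esP a b c u ->.
have [P1 P2 P3] : [/\ P e1, P e2 & P e3].
  by split; apply: esP; rewrite /= !inE eqxx ?orbT.
(* The hypotheses allow [eps] up to 48; from 1 on the left side is nonpositive. *)
have [eps1|eps1] := leP 1 eps.
  apply: le_trans (enorm_ge0 _).
  by rewrite mulr_le0_ge0 ?enorm_ge0 ?subr_le0.
rewrite -ler_sqr ?nnegrE ?enorm_ge0 // ?mulr_ge0 ?enorm_ge0 //; last by lra.
rewrite exprMn !enorm_sqr.
have [a' [b' [c' uE]]] := spanE a b c.
apply: le_trans (embedding_frame eps48 emb P0 P1 P2 P3 n1 n2 n3 p12 p13 p23 uE).
(* For [eps] below 1, [(1 - eps) ^+ 2 <= 1 - 15 * (eps / 48)]. *)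
by apply: (ler_wpM2r (dot_ge0 _)); nra.
Qed.

(** * Subdivisions of the unit interval and piecewise-linear interpolation *)

Definition subdivision (R : realType) (t : seq R) : Prop :=
  [/\ t`_0 = 0, last 0 t = 1 & sorted <%R t].

Lemma subdivision_size (R : realType) (t : seq R) :
  subdivision t -> (1 < size t)%N.
Proof.
case: t => [|a [|b t]] // [] /=.
  by move=> _ /eqP; rewrite eq_sym oner_eq0.
by move=> -> /eqP; rewrite eq_sym oner_eq0.
Qed.

Lemma subdivision_cover (R : realType) (t : seq R) (x : R) :
  subdivision t -> x \in `[0, 1] ->
  exists i s, [/\ (i.+1 < size t)%N, s \in `[0, 1] &
                  x = (1 - s) * t`_i + s * t`_i.+1].
Proof.
move=> sdt; have szt := subdivision_size sdt.
case: sdt => t0 t1 tS; rewrite in_itv /= => /andP[x0 x1].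
have ex : exists j, (j.+1 < size t)%N && (x <= t`_j.+1).
  exists (size t).-2; rewrite prednK ?nth_last ?t1 ?x1 ?andbT; lia.
case: (ex_minnP ex) => i /andP[it xi] imin.
have ix : t`_i <= x.
  case: i it xi imin => [|i] it xi imin; first by rewrite t0.
  rewrite leNgt; apply/negP => xti.
  by have := imin i; rewrite (ltnW it) (ltW xti) ltnn => /(_ isT).
have lt_i : t`_i < t`_i.+1.
  by apply: (sorted_ltn_nth lt_trans 0 tS); rewrite ?inE //; apply: ltnW.
exists i, ((x - t`_i) / (t`_i.+1 - t`_i)); split => //.
  rewrite in_itv /= divr_ge0 ?subr_ge0 ?(ltW lt_i) //=.
  by rewrite ler_pdivrMr ?subr_gt0 // mul1r lerD2r.
by field; lra.
Qed.

(** A sum of clamped ramps, one per cell of [t], each rising from 0 to the increment of [u] on its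
    cell. Continuity on all of [R] then follows termwise, without gluing. *)
Definition pl_interp (R : realType) (t u : seq R) (x : R) : R :=
  u`_0 + \sum_(i < (size t).-1) (u`_i.+1 - u`_i) *
    Num.max 0 (Num.min 1 ((x - t`_i) / (t`_i.+1 - t`_i))).

(** On cell [i] the earlier ramps are saturated and telescope to [u]_i - u[_0], the later ones
    vanish, and ramp [i] contributes the fraction [s] of its increment. *)
Lemma pl_interpE (R : realType) (t u : seq R) i (s : R) :
  sorted <%R t -> (i.+1 < size t)%N -> s \in `[0, 1] ->
  pl_interp t u ((1 - s) * t`_i + s * t`_i.+1) = (1 - s) * u`_i + s * u`_i.+1.
Proof.
move=> tS it; rewrite in_itv /= => /andP[s0 s1]; rewrite /pl_interp.
set x := (_ + _ * t`_i.+1).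
have tlt j k : (j < k)%N -> (k < size t)%N -> t`_j < t`_k.
  move=> jk kt; apply: (sorted_ltn_nth lt_trans 0 tS); rewrite ?inE //.
  exact: ltn_trans kt.
have tle j k : (j <= k)%N -> (k < size t)%N -> t`_j <= t`_k.
  by rewrite leq_eqVlt => /orP[/eqP -> //|jk kt]; apply/ltW/tlt.
have tii := tlt i i.+1 (ltnSn i) it.
have xl : t`_i <= x by rewrite /x; nra.
have xu : x <= t`_i.+1 by rewrite /x; nra.
pose F j := (u`_j.+1 - u`_j) *
    Num.max 0 (Num.min 1 ((x - t`_j) / (t`_j.+1 - t`_j))).
have Flt j : (j < i)%N -> F j = u`_j.+1 - u`_j.
  move=> ji; have jt : t`_j < t`_j.+1 by apply: tlt => //; lia.
  have jx : t`_j.+1 <= x by apply: le_trans xl; apply: tle => //; lia.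
  rewrite /F min_l; first by rewrite max_r ?ler01 ?mulr1.
  by rewrite ler_pdivlMr ?subr_gt0 // mul1r lerD2r.
have Fi : F i = s * (u`_i.+1 - u`_i).
  have -> : F i = (u`_i.+1 - u`_i) * Num.max 0 (Num.min 1 s).
    by congr (_ * Num.max _ (Num.min _ _)); rewrite /x; field; lra.
  by rewrite min_r // max_r // mulrC.
have Fgt j : (i < j < (size t).-1)%N -> F j = 0.
  move=> /andP[ij jt]; have jj : t`_j < t`_j.+1 by apply: tlt => //; lia.
  have xj : x <= t`_j by apply: le_trans xu _; apply: tle => //; lia.
  rewrite /F max_l ?mulr0 // ge_min; apply/orP; right.
  by rewrite ler_pdivrMr ?subr_gt0 // mul0r subr_le0.
have right : \sum_(i.+1 <= j < (size t).-1) F j = 0.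
  by rewrite big_nat big1 // => j /Fgt.
have left : \sum_(0 <= j < i) F j = u`_i - u`_0.
  rewrite big_nat (eq_bigr (fun j => u`_j.+1 - u`_j)); last by move=> j /Flt.
  by rewrite -big_nat telescope_sumr.
rewrite -(big_mkord xpredT F) (@big_cat_nat _ _ _ i.+1) //=; last by lia.
by rewrite right addr0 big_nat_recr //= left Fi; ring.
Qed.

Lemma continuous_clamp (R : realType) :
  continuous (fun y : R => Num.max 0 (Num.min 1 y)).
Proof.
move=> x; apply: (@continuous_max R R (cst 0) (fun y => Num.min 1 y)).
  exact: cst_continuous.
by apply: (@continuous_min R R (cst 1) id); [exact: cst_continuous|exact: cvg_id].
Qed.

Lemma continuous_pl_interp (R : realType) (t u : seq R) :
  continuous (pl_interp t u).
Proof.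
move=> x; apply: cvgD; first exact: cvg_cst.
elim: (size t).-1 => [|n IHn].
  by under eq_fun do rewrite big_ord0; rewrite big_ord0; exact: cvg_cst.
under eq_fun do rewrite big_ord_recr /=.
rewrite big_ord_recr /=; apply: cvgD => //.
apply: cvgM; first exact: cvg_cst.
apply: (@continuous_comp _ _ _ (fun y => (y - t`_n) / (t`_n.+1 - t`_n))
  (fun y : R => Num.max 0 (Num.min 1 y))); last exact: continuous_clamp.
apply: cvgM; last exact: cvg_cst.
by apply: cvgB; [exact: cvg_id|exact: cvg_cst].
Qed.

(** Both interpolations keep the cell index and the parameter [s], so exchanging the sequences
    inverts the map; this supplies the bijectivity in [reparam]. *)
Lemma pl_interpK (R : realType) (t u : seq R) :
  subdivision t -> sorted <%R u -> size t = size u ->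
  {in `[0, 1], cancel (pl_interp t u) (pl_interp u t)}.
Proof.
move=> sdt uS tu x x01.
have [i [s [it s01 ->]]] := subdivision_cover sdt x01.
have [_ _ tS] := sdt.
by rewrite !pl_interpE // -tu.
Qed.

Lemma pl_interp_itv (R : realType) (t u : seq R) (x : R) :
  subdivision t -> subdivision u -> size t = size u ->
  x \in `[0, 1] -> pl_interp t u x \in `[0, 1].
Proof.
move=> sdt [u0 u1 uS] tu x01.
have [i [s [it]]] := subdivision_cover sdt x01.
have [_ _ tS] := sdt.
move=> s01 ->; rewrite pl_interpE //.
have itu : (i.+1 < size u)%N by rewrite -tu.
have ule j k : (j <= k)%N -> (k < size u)%N -> u`_j <= u`_k.
  rewrite leq_eqVlt => /orP[/eqP -> //|jk ku].
  apply/ltW/(sorted_ltn_nth lt_trans 0 uS); rewrite ?inE //.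
  exact: ltn_trans ku.
have := ule 0 i isT (ltnW itu); have := ule i i.+1 (leqnSn i) itu.
have : u`_i.+1 <= u`_(size u).-1 by apply: ule; lia.
rewrite nth_last u0 u1; move: s01; rewrite !in_itv /= => /andP[s0 s1] ? ? ?.
by apply/andP; split; nra.
Qed.

Lemma pl_interp_reparam (R : realType) (t u : seq R) :
  subdivision t -> subdivision u -> size t = size u ->
  @reparam R (pl_interp t u).
Proof.
move=> sdt sdu tu.
have [t0 t1 tS] := sdt; have [u0 u1 uS] := sdu.
have szt := subdivision_size sdt.
split.
- by apply: continuous_subspaceT; exact: continuous_pl_interp.
- split.
  + by move=> x /= /(pl_interp_itv sdt sdu tu).
  + apply: (can_in_inj (g := pl_interp u t)) => x; rewrite inE => x01.
    exact: pl_interpK.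
  + move=> y /= y01; exists (pl_interp u t y) => /=.
      exact: (pl_interp_itv sdu sdt (esym tu)).
    exact: pl_interpK.
- rewrite -{2}u0 -{1}t0; have := @pl_interpE _ t u 0 0 tS szt.
  by rewrite in_itv /= lexx ler01 => /(_ isT); rewrite !(subr0, mul1r, mul0r, addr0).
(* The right endpoint is parameter 1 on the last cell, whose index is [(size t).-2]. *)
- have := @pl_interpE _ t u (size t).-2 1 tS.
  rewrite prednK; last lia.
  rewrite (_ : (size t).-1 < size t)%N; last lia.
  rewrite in_itv /= lexx ler01 => /(_ isT isT).
  by rewrite subrr !(mul0r, mul1r, add0r) nth_last t1 tu nth_last u1.
Qed.

(** * Piecewise-linear curves and their linear images *)

Lemma dotD_le (R : realType) d (x y : 'rV[R]_d) :
  dot (x + y) (x + y) <= 2 * (dot x x + dot y y).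
Proof. by have := dot_ge0 (x - y); rewrite !dotE (dotC y x); lra. Qed.

Lemma piecewise_linear_segment (R : realType) d (v : seq 'rV[R]_d) c x :
  piecewise_linear v c -> x \in `[0, 1] ->
  exists i s, [/\ (i.+1 < size v)%N, s \in `[0, 1] &
                  c x = (1 - s) *: v`_i + s *: v`_i.+1].
Proof.
move=> [_ [t [tv t0 t1 tS cE]]] x01.
have [i [s [it s01 ->]]] := subdivision_cover (And3 t0 t1 tS) x01.
by exists i, s; rewrite cE -?tv.
Qed.

(** Every point is a convex combination of two vertices, each with squared norm at most the sum over
    all vertices. Such bounds ensure that the [sup] in [width] is a genuine supremum. *)
Lemma piecewise_linear_bounded (R : realType) d (v : seq 'rV[R]_d) c :
  piecewise_linear v c ->
  exists M, forall x, x \in `[0, 1] -> dot (c x) (c x) <= M.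
Proof.
move=> plc; exists (4 * \sum_(p <- v) dot p p) => x x01.
have [i [s [iv]]] := piecewise_linear_segment plc x01.
rewrite in_itv /= => /andP[s0 s1] ->.
have le_sum j : (j < size v)%N -> dot v`_j v`_j <= \sum_(p <- v) dot p p.
  move=> jv; rewrite (big_rem v`_j) ?mem_nth //= lerDl.
  by apply: sumr_ge0 => p _; exact: dot_ge0.
have li := le_sum _ (ltnW iv); have lS := le_sum _ iv.
apply: le_trans (dotD_le _ _) _; rewrite !dotE.
have gi := dot_ge0 v`_i; have gS := dot_ge0 v`_i.+1.
have : (1 - s) * ((1 - s) * dot v`_i v`_i) <= dot v`_i v`_i.
  by rewrite mulrA ler_piMl //; nra.
have : s * (s * dot v`_i.+1 v`_i.+1) <= dot v`_i.+1 v`_i.+1.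
  by rewrite mulrA ler_piMl //; nra.
lra.
Qed.

(* The instants at which c' visits its vertices are unrelated to those of c. *)
Lemma piecewise_linear_map (R : realType) d d'
    (f : {linear 'rV[R]_d -> 'rV[R]_d'}) (v : seq 'rV[R]_d) c c' :
  piecewise_linear v c -> piecewise_linear (map f v) c' ->
  exists h, [/\ continuous h, reparam h &
                forall x, x \in `[0, 1] -> c' x = f (c (h x))].
Proof.
move=> [_ [t [tv t0 t1 tS cE]]] [_ [t' [tv' t0' t1' tS' cE']]].
rewrite size_map in tv' cE'.
have sdt' : subdivision t' by [].
exists (pl_interp t' t); split.
- exact: continuous_pl_interp.
- by apply: pl_interp_reparam; rewrite ?tv.
move=> x /(subdivision_cover sdt') [i [s [it s01 ->]]].
have iv : (i.+1 < size v)%N by rewrite -tv'.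
rewrite pl_interpE // cE' // cE // !(nth_map 0) ?(ltnW iv) //.
by rewrite linearD !linearZ.
Qed.

(** * Classes of reparametrizations and infima of widths *)

Lemma reparam_weak (R : realType) (a : R -> R) : reparam a -> weak_reparam a.
Proof. by move=> [ca [fa _ _] a0 a1]. Qed.

Lemma reparam_id (R : realType) : @reparam R id.
Proof.
split=> //; first by apply: continuous_subspaceT => x; exact: cvg_id.
by split=> [x //|x y _ _ //|y y01]; exists y.
Qed.

Lemma weak_reparam_comp (R : realType) (h a : R -> R) :
  continuous h -> weak_reparam h -> weak_reparam a -> weak_reparam (h \o a).
Proof.
move=> ch [_ fh h0 h1] [ca fa a0 a1]; split.
- by apply: within_continuous_comp => // x _; exact: ch.
- by move=> x /fa /fh.
- by rewrite /= a0.
- by rewrite /= a1.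
Qed.

Lemma reparam_comp (R : realType) (h a : R -> R) :
  continuous h -> reparam h -> reparam a -> reparam (h \o a).
Proof.
move=> ch rh ra.
have [cha fha ha0 ha1] :=
  weak_reparam_comp ch (reparam_weak rh) (reparam_weak ra).
split=> //; case: rh ra => [_ bh _ _] [_ ba _ _].
exact: set_bij_comp ba bh.
Qed.

(** For a set that is empty or unbounded above, [sup] takes the default value 0. *)
Lemma sup_nonneg (R : realType) (E : set R) :
  (forall x, E x -> 0 <= x) -> 0 <= sup E.
Proof.
move=> E0; have [[[x Ex] uE]|/sup_out -> //] := pselect (has_sup E).
exact: le_trans (E0 _ Ex) (ub_le_sup uE Ex).
Qed.

Lemma width_ge0 (R : realType) d (c1 c2 : R -> 'rV[R]_d) a b :
  0 <= width c1 c2 a b.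
Proof. by apply: sup_nonneg => _ [t _ <-]; exact: enorm_ge0. Qed.

Lemma inf_width_ge0 (R : realType) d (c1 c2 : R -> 'rV[R]_d)
    (Q : set (R -> R)) :
  Q id -> 0 <= inf [set width c1 c2 a b | a in Q & b in Q].
Proof.
move=> Qid; apply: lb_le_inf.
  by exists (width c1 c2 id id), id => //; exists id.
by move=> _ [a _ [b _ <-]]; exact: width_ge0.
Qed.

(** A pair [a], [b] for the primed curves yields the pair [h \o a], [k \o b] for the original ones,
    and the widths compare pointwise. The class [Q] is abstract so that one argument serves both
    distances. *)
Lemma inf_width_le (R : realType) d d' (c1 c2 : R -> 'rV[R]_d)
    (c1' c2' : R -> 'rV[R]_d') (h k : R -> R) (Q : set (R -> R)) (K M : R) :
  Q id -> (forall a, Q a -> set_fun `[0, 1] `[0, 1] a) ->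
  (forall a, Q a -> Q (h \o a)) -> (forall a, Q a -> Q (k \o a)) ->
  (forall x y, x \in `[0, 1] -> y \in `[0, 1] ->
     enorm (c1' x - c2' y) <= M) ->
  (forall x y, x \in `[0, 1] -> y \in `[0, 1] ->
     K * enorm (c1 (h x) - c2 (k y)) <= enorm (c1' x - c2' y)) ->
  K * inf [set width c1 c2 a b | a in Q & b in Q] <=
  inf [set width c1' c2' a b | a in Q & b in Q].
Proof.
move=> Qid Qfun Qh Qk bounded contract.
have [K0|K0] := leP K 0.
  apply: le_trans (inf_width_ge0 _ _ Qid).
  by rewrite mulr_le0_ge0 // inf_width_ge0.
apply: lb_le_inf; first by exists (width c1' c2' id id), id => //; exists id.
move=> _ [a Qa [b Qb <-]].
have : inf [set width c1 c2 a b | a in Q & b in Q] <=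
    width c1 c2 (h \o a) (k \o b).
  apply: ge_inf; last by exists (h \o a); [exact: Qh|exists (k \o b); [exact: Qk|]].
  by exists 0 => _ [? _ [? _ <-]]; exact: width_ge0.
rewrite -(ler_pM2l K0) => /le_trans; apply.
rewrite -ler_pdivlMl //; apply: ge_sup.
  by exists (enorm (c1 (h (a 0)) - c2 (k (b 0)))), 0; rewrite //= in_itv /= lexx ler01.
move=> _ [t t01 <-]; rewrite ler_pdivlMl //=.
have a01 := Qfun _ Qa _ t01; have b01 := Qfun _ Qb _ t01.
apply: le_trans (contract _ _ a01 b01) _.
apply: ub_le_sup; last by exists t.
exists M => _ [s s01 <-]; apply: bounded; [exact: (Qfun _ Qa)|exact: (Qfun _ Qb)].
Qed.

Theorem lemma14 (R : realType) :
  exists C : nat,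
  forall (d : nat) (sigma tau : R -> 'rV[R]_d) (vs vt : seq 'rV[R]_d),
    polygonal vs sigma -> polygonal vt tau ->
  exists P' : {fset 'rV[R]_d},
    (#|` P' | <= C * (size vs * size vt))%N /\
    forall (eps : R) (d' : nat) (f : {linear 'rV[R]_d -> 'rV[R]_d'})
           (sigma' tau' : R -> 'rV[R]_d'),
      0 < eps -> 0 < eps / 48 < 1 ->
      embedding (eps / 48) f ([set` vs] `|` [set` vt] `|` [set` P']) ->
      piecewise_linear (map f vs) sigma' ->
      piecewise_linear (map f vt) tau' ->
      (1 - eps) * weak_frechet sigma tau <= weak_frechet sigma' tau' /\
      (1 - eps) * frechet sigma tau <= frechet sigma' tau'.

Proof.
(* Three frame vectors per pair of indices and the origin: [1 + 3 * m * n <= 4 * m * n] once [m * n]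
   is positive. *)
exists 4%N => d sigma tau vs vt [pls _] [plt _].
have [es esE] := choice (fun p : nat * nat => embedding_span3
  (vs`_p.1 - vt`_p.2) (vs`_p.1.+1 - vs`_p.1) (vt`_p.2.+1 - vt`_p.2)).
(* At a last index the successor vertex is the default value 0 of [nth]; such pairs only add points
   to P'. *)
pose ijs := [seq (i, j) | i <- iota 0 (size vs), j <- iota 0 (size vt)].
pose ps := 0 :: flatten [seq tval (es p) | p <- ijs].
exists [fset x in ps]%fset; split.
  (* The instant 0 lies on some edge of each curve, so both vertex lists are nonempty and the origin
     is absorbed in the count. *)
  have : (0 : R) \in `[0, 1] by rewrite in_itv /= lexx ler01.
  move=> /[dup] /(piecewise_linear_segment pls)[i [_ [iv _ _]]].
  move=> /(piecewise_linear_segment plt)[j [_ [jv _ _]]].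
  have mn_gt0 : (0 < size vs * size vt)%N.
    by rewrite muln_gt0 (leq_ltn_trans _ iv) // (leq_ltn_trans _ jv).
  rewrite card_fseq (leq_trans (size_undup _)) //= size_flatten /shape -map_comp.
  have -> : sumn [seq (size \o (fun p => tval (es p))) p | p <- ijs] = (3 * size ijs)%N.
    by elim: (ijs) => //= p s ->; rewrite size_tuple mulnS.
  by rewrite size_allpairs !size_iota; lia.
move=> eps d' f sigma' tau' eps0 eps48 emb pls' plt'.
set P := (X in embedding _ _ X) in emb.
have psP x : x \in ps -> P x by move=> xps; rewrite /P; right; rewrite /= in_fset.
have P0 : P 0 by apply: psP; rewrite inE eqxx.
have [h [ch rh hE]] := piecewise_linear_map pls pls'.
have [k [ck rk kE]] := piecewise_linear_map plt plt'.
have [M1 M1E] := piecewise_linear_bounded pls'.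
have [M2 M2E] := piecewise_linear_bounded plt'.
(* A norm is at most one plus its square, so the bounds on squared norms suffice without taking
   roots. *)
have bounded x y : x \in `[0, 1] -> y \in `[0, 1] ->
    enorm (sigma' x - tau' y) <= 1 + 2 * (M1 + M2).
  move=> /M1E x01 /M2E y01; have := dotD_le (sigma' x) (- tau' y).
  have := enorm_sqr (sigma' x - tau' y); rewrite (dotNl (tau' y)) dotNr opprK.
  by have := sqr_ge0 (enorm (sigma' x - tau' y) - 1); nra.
have contract x y : x \in `[0, 1] -> y \in `[0, 1] ->
    (1 - eps) * enorm (sigma (h x) - tau (k y)) <= enorm (sigma' x - tau' y).
  move=> x01 y01; rewrite hE // kE // -linearB.
  have [_ [hfun _ _] _ _] := rh; have [_ [kfun _ _] _ _] := rk.
  have [i [s [iv s01 ->]]] := piecewise_linear_segment pls (hfun x x01).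
  have [j [r [jv r01 ->]]] := piecewise_linear_segment plt (kfun y y01).
  (* The difference of the two points is [v_i - w_j], plus [s] times the edge of [sigma], minus [r]
     times the edge of [tau]; hence the coefficients 1, [s], [- r]. *)
  apply: (esE (i, j) _ _ _ _ eps0 eps48 emb P0 _ 1 s (- r)).
    move=> e /= ee; apply: psP; rewrite inE; apply/orP; right.
    apply/flatten_mapP; exists (i, j) => //.
    by apply: (allpairs_f pair); rewrite mem_iota; lia.
  by apply/rowP => l; rewrite !mxE /=; ring.
split; apply: inf_width_le bounded contract.
- exact: reparam_weak (reparam_id R).
- by move=> a [].
- by move=> a; apply: weak_reparam_comp => //; exact: reparam_weak.
- by move=> a; apply: weak_reparam_comp => //; exact: reparam_weak.
- exact: reparam_id.
- by move=> a [_ []].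
- by move=> a; exact: reparam_comp.
- by move=> a; exact: reparam_comp.
Qed.
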